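(* Let $(G_t)_{t\ge0}$ be the discrete-time multigraph process on $V=[n]$ in which $G_0$ is the empty graph and, at each time step $t\ge1$, an edge $uv$ is selected uniformly at random (independently of previous choices, from all pairs of distinct vertices of $V$) and added to $G_{t-1}$ to form $G_t$. Let $\varepsilon>0$ be fixed. Then, as $n\to\infty$, $$\mathbb{P}(G_t\text{ is connected})\le n^{-\varepsilon+o(1)}\quad\text{for }t\le\frac{n\log n}{2}(1-\varepsilon),$$ $$\mathbb{P}(G_t\text{ is connected})\ge1-n^{-\varepsilon+o(1)}\quad\text{for }t\ge\frac{n\log n}{2}(1+\varepsilon).$$
   Context: Edges may be selected repeatedly (so $G_t$ is a multigraph with exactly $t$ edges counted with multiplicity). The $o(1)$ terms tend to $0$ as $n\to\infty$ and $t$ is a non-negative integer. *)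

(* Defs.v *)
From HB Require Import structures.
From mathcomp Require Import all_boot all_order all_algebra.
From mathcomp Require Import finmap multiset.
From mathcomp Require Import all_classical all_reals all_analysis.

Set Implicit Arguments.
Unset Strict Implicit.
Unset Printing Implicit Defensive.

Import Order.TTheory GRing.Theory Num.Theory.

Local Open Scope classical_set_scope.
Local Open Scope ring_scope.

(* Unordered pairs of distinct vertices of [n], the vertex set being 'I_n. *)
Notation edge n := {a : {set 'I_n} | #|a| == 2%N}.

Notation multigraph n := {mset edge n}%mset.

Definition edge_rel (n : nat) (G : multigraph n) : rel 'I_n :=
  fun u v => [exists a : edge n, (a \in G) && (val a == [set u; v]%SET)].

Definition connected_graph (n : nat) (G : multigraph n) : bool :=
  [forall u : 'I_n, forall v : 'I_n, connect (edge_rel G) u v].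

(* [e t] is the edge selected at time step [t.+1]. *)
Fixpoint graph_process (n : nat) (Omega : Type) (e : nat -> Omega -> edge n)
    (t : nat) (w : Omega) : multigraph n :=
  if t is t'.+1 then (e t' w +` graph_process e t' w)%mset else mset0.

(* The target U carries the discrete sigma-algebra. Plain functions rather than
   {RV P >-> U}: a measurableType is pointed, whereas edge n is empty for
   n < 2. *)
Definition measurable_discrete d (Omega : measurableType d) (U : Type)
    (X : Omega -> U) : Prop :=
  forall A : set U, measurable (X @^-1` A).

(* Mutual independence: the product rule for every finite subfamily. *)
Definition mutually_independent d (Omega : measurableType d) (R : realType)
    (P : probability Omega R) (U : Type) (X : nat -> Omega -> U) : Prop :=
  forall (J : {fset nat}) (A : nat -> set U),
    P (\bigcap_(i in [set` J]) (X i @^-1` A i)) =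
    (\prod_(i <- J) P (X i @^-1` A i))%E.

Definition uniformly_distributed d (Omega : measurableType d) (R : realType)
    (P : probability Omega R) (U : finType) (X : Omega -> U) : Prop :=
  forall a : U, P (X @^-1` [set a]) = (#|U|%:R^-1)%:E.

(* Main.v *)
(* The first t edges are uniform on the C(n,2)^t possible histories, so both
   bounds are counting statements.

   Lower range: the events "u is isolated" have probability ((n-2)/n)^t each and
   are pairwise negatively correlated, so the variance of the number of isolated
   vertices is at most its mean, and Chebyshev gives
   P(connected) <= 1 / (n ((n-2)/n)^t) <= n^(-eps + 2(1-eps)/(n-2)).

   Upper range: a disconnected graph has a vertex set A, 0 < |A| <= n/2, crossed
   by no edge. With a = 1+eps and s = |A| this has probability at most
   n^(-a s(n-s)/n) <= n^(-eps+a/n) (n^-s + e^-n) for large n. Summed over all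
   A, the last factor is (1+1/n)^n + (2/e)^n <= e + 1 <= e^2 = n^(2/ln n). *)
Require Import Defs.
From HB Require Import structures.
From mathcomp Require Import all_boot all_order all_algebra.
From mathcomp Require Import finmap multiset.
From mathcomp Require Import all_classical all_reals all_analysis.
From mathcomp Require Import ring lra zify.

Set Implicit Arguments.
Unset Strict Implicit.
Unset Printing Implicit Defensive.

Import Order.TTheory GRing.Theory Num.Theory.
Import numFieldNormedType.Exports.

Local Open Scope classical_set_scope.
Local Open Scope ring_scope.

(** * Law of the first [t] selections *)

Section process_law.
Context d (Omega : measurableType d) (R : realType) (P : probability Omega R).
Context (U : finType) (X : nat -> Omega -> U).
Context (mX : forall i, measurable_discrete (X i)).
Context (uX : forall i, uniformly_distributed P (X i)).
Context (iX : mutually_independent P X).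
Context (t : nat).

Let history (w : Omega) : {ffun 'I_t -> U} := [ffun i : 'I_t => X i w].

(** Independence is stated for sets indexed by all of [nat]. Quantifying the constraint over proofs
    of [i < t] makes it vacuous from index [t] on. *)
Let history_preimage1 f :
  history @^-1` [set f] =
  \bigcap_(i in [set` [fset val i | i in 'I_t]%fset])
    (X i @^-1` [set a | forall h : (i < t)%N, f (Ordinal h) = a]).
Proof.
apply/seteqP; split => w /=.
  by move=> <- i _ h; rewrite ffunE.
move=> fX; apply/ffunP => i; rewrite ffunE.
have it : (val i \in [fset val i | i in 'I_t]%fset) by apply/imfsetP; exists i.
by rewrite -(fX _ it (ltn_ord i)); congr (f _); apply: val_inj.
Qed.

Let measurable_history1 f : measurable (history @^-1` [set f]).
Proof.
rewrite history_preimage1; apply: fin_bigcap_measurable => // i _.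
exact: mX.
Qed.

Let probability_history1 f :
  P (history @^-1` [set f]) = ((#|U|%:R ^+ t)^-1)%:E.
Proof.
rewrite history_preimage1 iX big_imfset/=; last by move=> ? ? _ _; apply: val_inj.
rewrite big_enum /=.
rewrite (eq_bigr (fun=> (#|U|%:R^-1)%:E)) => [|i _].
  by rewrite prodEFin prodr_const card_ord exprVn.
rewrite -(uX i (f i)); congr (P (_ @^-1` _)).
apply/seteqP; split => a /=.
  move=> /(_ (ltn_ord i)) <-; congr (f _); exact: val_inj.
by move=> -> h; congr (f _); apply: val_inj.
Qed.

(** This turns probabilities into counts: by independence every history has the same mass, and the
    event is a finite disjoint union of fibres. *)
Lemma probability_history (Q : {set {ffun 'I_t -> U}}) :
  P [set w | [ffun i : 'I_t => X i w] \in Q] = (#|Q|%:R / #|U|%:R ^+ t)%:E.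
Proof.
have -> : [set w | [ffun i : 'I_t => X i w] \in Q] =
    \bigcup_(f in [set` enum Q]) history @^-1` [set f].
  apply/seteqP; split => w /=; first by exists (history w) => //=; rewrite mem_enum.
  by case=> f /=; rewrite mem_enum => + fw; rewrite -fw.
rewrite measure_fin_bigcup//; last by move=> f g _ _ [w [/= <- <-]].
rewrite -fsbig_seq ?enum_uniq// big_enum/=.
rewrite (eq_bigr (fun=> ((#|U|%:R ^+ t)^-1)%:E)) => [|f _].
  by rewrite sumEFin sumr_const mulr_natl.
exact: probability_history1.
Qed.
End process_law.

(** * Chebyshev's inequality in counting form *)

Lemma second_moment_method (R : realFieldType) (T I : finType)
    (B : I -> {set T}) (p : R) :
  0 <= p ->
  (forall i, #|B i|%:R = p * #|T|%:R) ->
  (forall i j, i != j -> #|B i :&: B j|%:R <= p ^+ 2 * #|T|%:R) ->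
  #|[set x | [forall i, x \notin B i]]%SET|%:R * (#|I|%:R * p) <= #|T|%:R.
Proof.
move=> p0 B1 B2; set D := [set x | _]%SET; set mu := #|I|%:R * p.
have [->|mu0] := eqVneq mu 0; first by rewrite mulr0.
have {}mu0 : 0 < mu by rewrite lt_def mu0 mulr_ge0.
(* For [x] uniform on [T], [X] has mean [mu]. The two bounds below say that its variance is at most
   [mu]. *)
pose X x : R := \sum_i (x \in B i)%:R.
have sum_mem (A : {set T}) : \sum_x (x \in A)%:R = #|A|%:R :> R.
  by rewrite -natr_sum -sum1_card [in RHS]big_mkcond; congr _%:R;
    apply: eq_bigr => x _; case: (x \in A).
have X1 : \sum_x X x = mu * #|T|%:R.
  rewrite exchange_big /= (eq_bigr (fun=> p * #|T|%:R)) => [|i _].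
    by rewrite sumr_const /mu -mulrA mulr_natl.
  by rewrite sum_mem B1.
have X2 : \sum_x X x ^+ 2 <= mu * #|T|%:R + mu ^+ 2 * #|T|%:R.
  have -> : \sum_x X x ^+ 2 = \sum_i \sum_j #|B i :&: B j|%:R.
    transitivity (\sum_x \sum_i \sum_j (x \in B i :&: B j)%:R : R).
      apply: eq_bigr => x _; rewrite expr2 mulr_suml; apply: eq_bigr => i _.
      by rewrite mulr_sumr; apply: eq_bigr => j _; rewrite inE -natrM mulnb.
    rewrite exchange_big; apply: eq_bigr => i _.
    by rewrite exchange_big; apply: eq_bigr => j _; rewrite sum_mem.
  have -> : mu * #|T|%:R + mu ^+ 2 * #|T|%:R =
      \sum_(i : I) (p * #|T|%:R + \sum_(j : I) p ^+ 2 * #|T|%:R).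
    by rewrite !sumr_const /mu; ring.
  (* The diagonal term is exactly [p * #|T|]. The right side has a spare nonnegative term at
     [j = i], which is dropped. *)
  apply: ler_sum => i _; rewrite (bigD1 i)//= finset.setIid B1 lerD2l.
  rewrite [leRHS](bigD1 i)//= ler_wpDl ?mulr_ge0 ?sqr_ge0//.
  by apply: ler_sum => j ji; apply: B2; rewrite eq_sym.
rewrite -(ler_pM2r mu0) -mulrA -expr2.
(* [X] vanishes on [D], so each point of [D] contributes [mu ^+ 2]. *)
apply: (@le_trans _ _ (\sum_x (X x - mu) ^+ 2)).
  rewrite [leRHS](bigID (mem D))/= ler_wpDr ?sumr_ge0// => [x _|].
    exact: sqr_ge0.
  rewrite mulr_natl -sumr_const ler_sum// => x; rewrite inE => /forallP xB.
  by rewrite /X big1 => [|i _]; rewrite ?sub0r ?sqrrN// (negbTE (xB i)).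
have -> : \sum_x (X x - mu) ^+ 2 =
    \sum_x X x ^+ 2 - 2 * mu * \sum_x X x + mu ^+ 2 * #|T|%:R.
  rewrite mulr_sumr mulr_natr -sumr_const -sumrB -big_split/=.
  by apply: eq_bigr => x _; ring.
rewrite X1; lra.
Qed.

(** * Histories and their counting *)

Definition edges_within n (B : {set 'I_n}) : {set edge n} :=
  [set a : edge n | val a \subset B]%SET.

Lemma card_edges_within n (B : {set 'I_n}) : #|edges_within B| = 'C(#|B|, 2).
Proof.
rewrite -cards_draws -(card_imset _ val_inj); apply: eq_card => A.
rewrite !inE; apply/imsetP/andP => [[a + ->]|[AB A2]].
  by rewrite inE (valP a).
by exists (Sub A A2); rewrite ?inE ?SubK.
Qed.

Definition history_rel n t (tau : {ffun 'I_t -> edge n}) : rel 'I_n :=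
  fun u v => [exists i, val (tau i) == [set u; v]%SET].

Definition connected_histories n t : {set {ffun 'I_t -> edge n}} :=
  [set tau : {ffun 'I_t -> edge n} |
    [forall u, forall v, connect (history_rel tau) u v]]%SET.

(** Connectedness depends only on which edges occur, not on their multiplicities, and these are the
    values of the history. *)
Lemma connected_graph_process n (Omega : Type) (e : nat -> Omega -> edge n) t w :
  connected_graph (graph_process e t w) =
  ([ffun i : 'I_t => e i w] \in connected_histories n t).
Proof.
rewrite inE; apply: eq_forallb => u; apply: eq_forallb => v.
apply: eq_connect => {u v} u v.
have mem_process a : (a \in graph_process e t w) = [exists i : 'I_t, e i w == a].
  elim: t => [|t IH] /=.
    by rewrite in_mset0; apply/esym/existsP => -[[]].
  rewrite in_mset1D IH; apply/orP/existsP.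
    case=> [/eqP ->|/existsP[i ia]]; first by exists ord_max.
    by exists (widen_ord (leqnSn t) i).
  case=> i; have [it|it] := ltnP i t => ia.
    by right; apply/existsP; exists (Ordinal it).
  have /eqP <- : val i == t by rewrite eqn_leq it -ltnS ltn_ord.
  by left; rewrite eq_sym.
apply/existsP/existsP => [[a /andP[+ auv]]|[i]]; last first.
  rewrite ffunE => auv; exists (e i w); rewrite auv andbT mem_process.
  by apply/existsP; exists i.
by rewrite mem_process => /existsP[i /eqP ia]; exists i; rewrite ffunE ia.
Qed.

Lemma natr_bin2 (R : numFieldType) m : 'C(m, 2)%:R = m%:R * (m%:R - 1) / 2 :> R.
Proof.
case: m => [|m]; first by rewrite bin0n mul0r mul0r.
have /(congr1 (fun k => k%:R : R)) := mul_bin_diag m.+1 1.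
rewrite /= bin1 !natrM -natr1 => H.
by rewrite addrK H mulrC mulKf// pnatr_eq0.
Qed.

Lemma card_edge n : #|{: edge n}| = 'C(n, 2).
Proof.
have := card_edges_within [set: 'I_n]%SET.
rewrite cardsT card_ord => <-; rewrite -cardsT.
by apply: eq_card => a; rewrite !inE finset.subsetT.
Qed.

(** Common shape of the isolation and cut events: every step is confined to one fixed edge set, so
    the count is a power. *)
Definition histories_in (U : finType) t (F : {set U}) : {set {ffun 'I_t -> U}} :=
  [set tau : {ffun 'I_t -> U} | [forall i, tau i \in F]]%SET.

Lemma card_histories_in (U : finType) t (F : {set U}) :
  #|histories_in t F| = (#|F| ^ t)%N.
Proof.
rewrite -[in RHS](card_ord t) -card_ffun_on; apply: eq_card => tau.
by rewrite inE; apply/forallP/ffun_onP.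
Qed.

(** * Isolated vertices *)

Definition isolated_histories n t (u : 'I_n) : {set {ffun 'I_t -> edge n}} :=
  histories_in t (edges_within (~: [set u]%SET)).

Lemma card_isolated_histories n t (u : 'I_n) :
  #|isolated_histories t u| = ('C(n.-1, 2) ^ t)%N.
Proof. by rewrite card_histories_in card_edges_within cardsC1 card_ord. Qed.

Lemma card_isolated_histories2 n t (u v : 'I_n) : u != v ->
  #|isolated_histories t u :&: isolated_histories t v| = ('C(n.-2, 2) ^ t)%N.
Proof.
move=> uv; have -> : n.-2 = #|~: [set u; v]%SET|.
  by rewrite -[n in LHS]card_ord -(cardsC [set u; v]%SET) cards2 uv.
rewrite -card_edges_within -card_histories_in; apply: eq_card => tau.
rewrite !inE; apply/andP/forallP => [[/forallP tu /forallP tv] i|H].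
  by move: (tu i) (tv i); rewrite !inE finset.setCU finset.subsetI => -> ->.
by split; apply/forallP => i; move: (H i);
  rewrite !inE finset.setCU finset.subsetI => /andP[].
Qed.

(** The first edge of a path from [u] to another vertex would contain [u]; [1 < n] provides that
    other vertex. *)
Lemma isolated_not_connected n t (u : 'I_n) tau : (1 < n)%N ->
  tau \in isolated_histories t u -> tau \notin connected_histories n t.
Proof.
move=> n1; rewrite !inE => /forallP iso; apply/negP => /forallP/(_ u)/forallP conn.
have /card_gt0P[v] : (0 < #|[set~ u]%SET|)%N.
  by rewrite cardsC1 card_ord -ltnS prednK// ltnW.
rewrite !inE => vu; have /connectP[[|w p] /=] := conn v.
  by move=> _ vE; rewrite vE eqxx in vu.
move=> /andP[/existsP[i /eqP tauE] _] _.
move: (iso i); rewrite inE tauE => /fintype.subsetP/(_ u).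
by rewrite !inE eqxx => /(_ isT).
Qed.

Lemma card_connected_histories_le (R : realFieldType) n t : (2 < n)%N ->
  #|connected_histories n t|%:R * (n%:R * ((n%:R - 2) / n%:R) ^+ t)
    <= #|{: edge n}|%:R ^+ t :> R.
Proof.
move=> n2.
have nR : 3 <= n%:R :> R by rewrite ler_nat.
have C0 : 'C(n, 2)%:R ^+ t != 0 :> R.
  by rewrite expf_neq0// pnatr_eq0 -lt0n bin_gt0 ltnW.
have cardT : #|{: {ffun 'I_t -> edge n}}|%:R = #|{: edge n}|%:R ^+ t :> R.
  by rewrite card_ffun card_ord natrX.
have n1E : n.-1%:R = n%:R - 1 :> R by rewrite -subn1 natrB// ltnW// ltnW.
have n2E : n.-2%:R = n%:R - 2 :> R by rewrite -subn2 natrB// ltnW.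
have := @second_moment_method R _ _ (@isolated_histories n t)
  (((n%:R - 2) / n%:R) ^+ t).
rewrite cardT card_ord card_edge => H.
apply: le_trans (H _ _ _).
- rewrite ler_pM2r; last first.
    by rewrite mulr_gt0 ?exprn_gt0 ?divr_gt0//; lra.
  rewrite ler_nat; apply/subset_leq_card/fintype.subsetP => tau tconn.
  rewrite inE; apply/forallP => u; apply: contraL tconn.
  by apply: isolated_not_connected; rewrite ltnW.
- by rewrite exprn_ge0// divr_ge0//; lra.
- move=> u; rewrite card_isolated_histories natrX -exprMn; congr (_ ^+ _).
  rewrite !natr_bin2 n1E; field; lra.
(* Negative correlation is checked for a single step, then raised to the power [t]; the one-step gap
   is exactly [(n - 2) / n]. *)
- move=> u v uv; rewrite card_isolated_histories2// natrX -exprM mulnC exprM -exprMn.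
  apply: lerXn2r; rewrite ?nnegrE ?mulr_ge0// ?sqr_ge0//; try lra.
  rewrite !natr_bin2 n2E -subr_ge0.
  have -> : ((n%:R - 2) / n%:R) ^+ 2 * (n%:R * (n%:R - 1) / 2) -
     (n%:R - 2) * (n%:R - 2 - 1) / 2 = (n%:R - 2) / n%:R :> R by field; lra.
  by rewrite divr_ge0//; lra.
Qed.

(** * Cuts crossed by no edge *)

Definition uncrossed_histories n t (A : {set 'I_n}) : {set {ffun 'I_t -> edge n}} :=
  histories_in t (edges_within A :|: edges_within (~: A)).

Lemma card_uncrossed_histories n t (A : {set 'I_n}) :
  #|uncrossed_histories t A| = (('C(#|A|, 2) + 'C(n - #|A|, 2)) ^ t)%N.
Proof.
rewrite card_histories_in; congr (_ ^ _)%N.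
have -> : (n - #|A|)%N = #|~: A| by have := cardsC A; rewrite card_ord; lia.
rewrite -!card_edges_within -cardsUI.
(* The two edge sets are disjoint: an edge inside both [A] and its complement would be empty. *)
rewrite [X in (_ + X)%N]eq_card0 ?addn0 => [|a].
  by apply: eq_card => a; rewrite !inE.
rewrite !inE -finset.subsetI finset.setICr finset.subset0 -cards_eq0.
by rewrite (eqP (valP a)).
Qed.

(* Replacing a component by its complement allows the size to be at most n/2. *)
Lemma not_connected_uncrossed n t tau : tau \notin connected_histories n t ->
  exists A : {set 'I_n},
    [&& (0 < #|A|)%N, (#|A|.*2 <= n)%N & tau \in uncrossed_histories t A].
Proof.
rewrite inE negb_forall => /existsP[u]; rewrite negb_forall => /existsP[v uv].
pose A := [set x | connect (history_rel tau) u x]%SET.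
have uA : u \in A by rewrite inE connect0.
have vA : v \in ~: A by rewrite !inE.
have tauA : tau \in uncrossed_histories t A.
  rewrite inE; apply/forallP => i; rewrite !inE.
  have /cards2P[x [y [xy tauE]]] := valP (tau i).
  have step : history_rel tau x y by apply/existsP; exists i; apply/eqP.
  have step' : history_rel tau y x.
    by apply/existsP; exists i; rewrite tauE finset.setUC.
  have xyA : (x \in A) = (y \in A).
    rewrite !inE; apply/idP/idP => ?.
      exact: connect_trans (connect1 step).
    exact: connect_trans (connect1 step').
  rewrite tauE !finset.subUset !finset.sub1set !inE.
  by move: xyA; rewrite !inE => ->; rewrite !andbb orbN.
have tauAC : tau \in uncrossed_histories t (~: A).
  by rewrite /uncrossed_histories finset.setCK finset.setUC.
have [An|An] := leqP #|A|.*2 n.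
  by exists A; rewrite An tauA !andbT; apply/card_gt0P; exists u.
exists (~: A); rewrite tauAC andbT; apply/andP; split.
  by apply/card_gt0P; exists v.
move: (cardsC A) An; rewrite card_ord -!addnn.
by move: #|A| #|~: A| => a b; lia.
Qed.

Lemma card_bigcup_le (T I : finType) (P : pred I) (F : I -> {set T}) :
  (#|\bigcup_(i | P i) F i| <= \sum_(i | P i) #|F i|)%N.
Proof.
elim/big_ind2: _ => [|m A k B Am Bk|//]; first by rewrite cards0.
by rewrite (leq_trans (leq_card_setU _ _))// leq_add.
Qed.

(** Union bound over the cuts supplied by [not_connected_uncrossed]. *)
Lemma card_not_connected_le n t :
  (#|~: connected_histories n t| <=
   \sum_(A : {set 'I_n} | (0 < #|A|) && (#|A|.*2 <= n))
      ('C(#|A|, 2) + 'C(n - #|A|, 2)) ^ t)%N.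
Proof.
under eq_bigr do rewrite -card_uncrossed_histories.
apply: leq_trans (card_bigcup_le _ _).
apply/subset_leq_card/fintype.subsetP => tau; rewrite inE => /not_connected_uncrossed.
by move=> [A /and3P[A0 An tauA]]; apply/finset.bigcupP; exists A; rewrite ?A0.
Qed.

(** * Exponential estimates for the lower range *)

Lemma powR_natE (R : realType) n (x : R) : (0 < n)%N ->
  n%:R `^ x = expR (x * ln n%:R).
Proof. by move=> n0; rewrite /powR pnatr_eq0 gtn_eqF. Qed.

Lemma connected_fraction_le (R : realType) (eps : R) n t : (2 < n)%N ->
  t%:R <= n%:R * ln n%:R / 2 * (1 - eps) ->
  #|connected_histories n t|%:R / #|{: edge n}|%:R ^+ t
    <= n%:R `^ (- eps + 2 * (1 - eps) / (n%:R - 2)) :> R.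
Proof.
move=> n2 tle; have := @card_connected_histories_le R n t n2.
have nR : 3 <= n%:R :> R by rewrite ler_nat.
have n0 : 0 < n%:R :> R by lra.
set c := #|_|%:R; set p := (_ / n%:R); set M := #|_|%:R ^+ t => cM.
have M0 : 0 < M.
  by rewrite exprn_gt0// card_edge ltr0n bin_gt0 ltnW.
have q0 : 0 < n%:R - 2 :> R by lra.
have p0 : 0 < p by rewrite divr_gt0.
rewrite ler_pdivrMr//; apply: (le_trans _ (ler_wpM2l _ cM)); last exact: powR_ge0.
rewrite mulrCA ler_peMr//.
rewrite powR_natE; last by rewrite ltnW// ltnW.
set L := ln _ in tle *.
have nE : n%:R = expR L :> R by rewrite lnK// posrE.
(* A lower bound on [p] is needed, so [1 + x <= expR x] is applied to [p^-1 = 1 + 2 / (n - 2)]. *)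
have pE : expR (- (2 / (n%:R - 2))) <= p.
  rewrite expRN -[p]invrK lef_pV2 ?posrE ?invr_gt0 ?expR_gt0//.
  apply: le_trans (expR_ge1Dx _); rewrite le_eqVlt; apply/orP; left; apply/eqP.
  by rewrite /p; field; lra.
have ptE : expR (- (2 / (n%:R - 2)) * t%:R) <= p ^+ t.
  by rewrite expRM_natr lerXn2r// nnegrE ?expR_ge0 ?ltW.
apply: (@le_trans _ _ (expR ((- eps + 2 * (1 - eps) / (n%:R - 2)) * L) *
    (n%:R * expR (- (2 / (n%:R - 2)) * t%:R)))); last first.
  by rewrite ler_wpM2l ?expR_ge0// ler_wpM2l// ltW.
have -> y : n%:R * expR y = expR (L + y) by rewrite expRD -nE.
rewrite -expRD -[leLHS]expR0 ler_expR.
(* The correction [2 * (1 - eps) / (n - 2)] is chosen to make the exponent a positive multiple of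
   the slack in the hypothesis on [t]. *)
have -> : (- eps + 2 * (1 - eps) / (n%:R - 2)) * L +
    (L + - (2 / (n%:R - 2)) * t%:R) =
  2 / (n%:R - 2) * (n%:R * L / 2 * (1 - eps) - t%:R) by field; lra.
by rewrite mulr_ge0 ?subr_ge0// divr_ge0// ltW.
Qed.

(** * Exponential estimates for the upper range *)

Lemma uncrossed_fraction_le (R : realType) (eps : R) n t s : 0 < eps ->
  (8 <= n)%N -> 8 <= eps * ln n%:R ->
  n%:R * ln n%:R / 2 * (1 + eps) <= t%:R ->
  (0 < s)%N -> (s.*2 <= n)%N ->
  (('C(s, 2) + 'C(n - s, 2)) ^ t)%N%:R / 'C(n, 2)%:R ^+ t
    <= n%:R `^ (- eps + (1 + eps) / n%:R) * (n%:R^-1 ^+ s + expR (-1) ^+ n) :> R.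
Proof.
move=> e0 n8 eL let_ s0 sn.
have nR : 8 <= n%:R :> R by rewrite ler_nat.
have sR : 1 <= s%:R :> R by rewrite ler1n.
have snR : s%:R * 2 <= n%:R :> R by rewrite -natrM muln2 ler_nat.
have snn : (s <= n)%N by lia.
rewrite natrX -expr_div_n natrD !natr_bin2 natrB// powR_natE; last by lia.
set S := s%:R in sR snR *; set N := n%:R in nR snR let_ eL *.
set L := ln N in eL let_ *.
have NE : N^-1 = expR (- L) by rewrite expRN lnK// posrE; lra.
have L0 : 0 < L by rewrite -(pmulr_rgt0 _ e0); lra.
set b := (X in X ^+ t).
have b0 : 0 <= b.
  have S1 : 0 <= S * (S - 1) by rewrite mulr_ge0; lra.
  have S2 : 0 <= (N - S) * (N - S - 1) by rewrite mulr_ge0; lra.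
  have N2 : 0 <= N * (N - 1) by rewrite mulr_ge0; lra.
  by rewrite /b divr_ge0//; lra.
(* A uniform edge crosses the cut with probability [2 * S * (N - S) / (N * (N - 1))], and [b] is the
   complementary probability. *)
have bE : b <= expR (- (2 * (S * (N - S)) / (N * (N - 1)))).
  apply: le_trans (expR_ge1Dx _); rewrite le_eqVlt; apply/orP; left; apply/eqP.
  by rewrite /b; field; lra.
have {b0}bt : b ^+ t <= expR (- ((1 + eps) * L * (S * (N - S) / N))).
  apply: (@le_trans _ _ (expR (- (2 * (S * (N - S)) / (N * (N - 1)))) ^+ t)).
    by rewrite lerXn2r// nnegrE ?expR_ge0.
  rewrite -expRM_natr ler_expR mulNr lerN2.
  have -> : 2 * (S * (N - S)) / (N * (N - 1)) * t%:R =
    S * (N - S) / N * (2 * t%:R / (N - 1)) by field; lra.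
  rewrite mulrC ler_wpM2l//.
    by rewrite divr_ge0// ?mulr_ge0//; lra.
  rewrite ler_pdivlMr; last by lra.
  nra.
apply: le_trans bt _.
(* For small s the per-set bound n^(-eps s + O(s^2/n)) beats n^-s times the
     target; for linear s it is n^(-Omega(n)), which absorbs the 2^n sets. *)
have [small|large] := lerP (2 * (1 + eps) * S) (eps * N).
  apply: (@le_trans _ _ (expR ((- eps + (1 + eps) / N) * L) * N^-1 ^+ s)); last first.
    by rewrite ler_wpM2l ?expR_ge0// lerDl exprn_ge0// expR_ge0.
  have -> : N^-1 ^+ s = expR (- L * S) by rewrite NE expRM_natr.
  rewrite -expRD ler_expR -subr_ge0.
  (* The gap vanishes at [S = 1], which is where the term [(1 + eps) / N] comes from. For [S >= 1],
     [S + 1 <= 2 * S] and the case assumption make the last factor nonnegative. *)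
  have -> : (- eps + (1 + eps) / N) * L + - L * S -
      - ((1 + eps) * L * (S * (N - S) / N)) =
    L / N * ((S - 1) * (eps * N - (1 + eps) * (S + 1))) by field; lra.
  rewrite mulr_ge0 ?divr_ge0 ?mulr_ge0//; nra.
apply: (@le_trans _ _ (expR ((- eps + (1 + eps) / N) * L) * expR (-1) ^+ n)); last first.
  by rewrite ler_wpM2l ?expR_ge0// lerDr exprn_ge0// invr_ge0 ler0n.
rewrite -expRM_natr -expRD ler_expR -/N.
have y : S / 2 <= S * (N - S) / N.
  by rewrite ler_pdivlMr; nra.
have : eps * N / 4 * L <= (1 + eps) * L * (S * (N - S) / N).
  apply: (@le_trans _ _ ((1 + eps) * L * (S / 2))); last first.
    by rewrite ler_wpM2l// mulr_ge0//; lra.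
  have -> : (1 + eps) * L * (S / 2) = (2 * (1 + eps) * S) / 4 * L by field.
  by rewrite ler_wpM2r//; lra.
have : 0 <= (1 + eps) / N * L by rewrite mulr_ge0 ?divr_ge0//; lra.
(* Both thresholds 8 enter here: half of the right side dominates [eps * L] because [N >= 8], the
   other half dominates [N] because [eps * L >= 8]. *)
have : eps * L + N <= eps * N / 4 * L by nra.
by rewrite mulrDl; lra.
Qed.

(** Expanding the product of [#|T|] factors [1 + x] gives one term per subset. *)
Lemma sum_expr_card (R : comPzRingType) (T : finType) (x : R) :
  \sum_(A : {set T}) x ^+ #|A| = (1 + x) ^+ #|T|.
Proof.
rewrite addrC -prodr_const bigA_distr; apply: eq_bigr => A _.
by rewrite -big_mkcond prodr_const.
Qed.

Lemma not_connected_fraction_le (R : realType) (eps : R) n t : 0 < eps ->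
  (8 <= n)%N -> 8 <= eps * ln n%:R ->
  n%:R * ln n%:R / 2 * (1 + eps) <= t%:R ->
  #|~: connected_histories n t|%:R / #|{: edge n}|%:R ^+ t
    <= n%:R `^ (- eps + ((1 + eps) / n%:R + 2 / ln n%:R)) :> R.
Proof.
move=> e0 n8 eL let_.
have n0 : (0 < n)%N by lia.
have nR : 0 < n%:R :> R by rewrite ltr0n.
have L0 : 0 < ln n%:R :> R by rewrite -(pmulr_rgt0 _ e0); lra.
have M0 : 0 < 'C(n, 2)%:R ^+ t :> R.
  by rewrite exprn_gt0// ltr0n bin_gt0; lia.
rewrite card_edge; set c := (_ / _).
apply: (@le_trans _ _ (\sum_(A : {set 'I_n}) n%:R `^ (- eps + (1 + eps) / n%:R) *
   (n%:R^-1 ^+ #|A| + expR (-1) ^+ n))).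
  apply: (@le_trans _ _ (\sum_(A : {set 'I_n} | ((0 < #|A|) && (#|A|.*2 <= n))%N)
      (('C(#|A|, 2) + 'C(n - #|A|, 2)) ^ t)%N%:R / 'C(n, 2)%:R ^+ t)).
    rewrite -mulr_suml ler_wpM2r ?invr_ge0 ?(ltW M0)//.
    by rewrite -natr_sum ler_nat card_not_connected_le.
  (* The bound is nonnegative, so the sum may run over all subsets, where it has a closed form. *)
  rewrite big_mkcond/=; apply: ler_sum => A _; case: ifPn => [/andP[A0 An]|_].
    exact: uncrossed_fraction_le.
  by rewrite mulr_ge0 ?powR_ge0// addr_ge0// exprn_ge0 ?expR_ge0// invr_ge0 ltW.
rewrite -mulr_sumr big_split/= sum_expr_card card_ord.
have -> : \sum_(A : {set 'I_n}) expR (-1) ^+ n = (2 * expR (-1)) ^+ n :> R.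
  transitivity (\sum_(A : {set 'I_n}) 1 ^+ #|A| * expR (-1) ^+ n : R).
    by apply: eq_bigr => A _; rewrite expr1n mul1r.
  by rewrite -mulr_suml sum_expr_card card_ord exprMn.
have -> : n%:R `^ (- eps + ((1 + eps) / n%:R + 2 / ln n%:R)) =
    n%:R `^ (- eps + (1 + eps) / n%:R) * expR 2 :> R.
  by rewrite !powR_natE// -expRD; congr expR; field; lra.
rewrite ler_wpM2l ?powR_ge0//.
have e2 : 2 <= expR 1 :> R by apply: le_trans (expR_ge1Dx _); lra.
have -> : expR 2 = expR 1 * expR 1 :> R by rewrite -expRD; congr expR; lra.
have : (1 + n%:R^-1) ^+ n <= expR 1 :> R.
  rewrite -[X in expR X](@mulVf _ n%:R) ?gt_eqF// expRM_natr lerXn2r//.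
  - by rewrite nnegrE addr_ge0// invr_ge0 ltW.
  - by rewrite nnegrE expR_ge0.
  - exact: expR_ge1Dx.
have : (2 * expR (-1)) ^+ n <= 1 :> R.
  by rewrite expRN exprn_ile1 ?divr_ge0 ?expR_ge0// ler_pdivrMr ?expR_gt0// mul1r.
(* The two sums total at most [expR 1 + 1], which is at most [expR 1 * expR 1] since
   [expR 1 >= 2]. *)
nra.
Qed.

(** * Limits of the error terms and the final assembly *)

Lemma cvg_const_div (R : realType) (c : R) (f : nat -> R) :
  f n @[n --> \oo] --> +oo -> c / f n @[n --> \oo] --> 0.
Proof.
move=> foo; rewrite -[X in _ --> X](mulr0 c); apply: cvgMr.
apply/gtr0_cvgV0 => //; by have /cvgryPgt := foo; exact.
Qed.

Lemma cvg_ln_nat (R : realType) : ln (n%:R : R) @[n --> \oo] --> +oo.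
Proof.
apply/cvgryPge => A; near=> n.
have nA : expR A <= n%:R :> R by near: n; exact: nbhs_infty_ger.
rewrite -[A]expRK ler_ln ?posrE ?expR_gt0//.
exact: lt_le_trans (expR_gt0 A) nA.
Unshelve. all: by end_near.
Qed.

Theorem theorem5p1 (R : realType) (eps : R) (heps : 0 < eps) :
  exists o1 o2 : nat -> R,
    [/\ o1 n @[n --> \oo] --> 0,
        o2 n @[n --> \oo] --> 0 &
        forall (n : nat) (d : measure_display) (Omega : measurableType d)
               (P : probability Omega R) (e : nat -> Omega -> edge n),
          (forall i : nat, measurable_discrete (e i)) ->
          (forall i : nat, uniformly_distributed P (e i)) ->
          mutually_independent P e ->
          forall t : nat,
            (t%:R <= n%:R * ln n%:R / 2 * (1 - eps) ->
             (P [set w | connected_graph (graph_process e t w)]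
                <= (n%:R `^ (- eps + o1 n))%:E)%E) /\
            (n%:R * ln n%:R / 2 * (1 + eps) <= t%:R ->
             ((1 - n%:R `^ (- eps + o2 n))%:E
                <= P [set w | connected_graph (graph_process e t w)])%E)].
Proof.
(* For the finitely many remaining n, taking o(1) = eps makes the bounds trivial. *)
pose big n := (8 <= n)%N && (8 <= eps * ln n%:R).
exists (fun n => if (2 < n)%N then 2 * (1 - eps) / (n%:R - 2) else eps).
exists (fun n => if big n then (1 + eps) / n%:R + 2 / ln n%:R else eps).
split.
- apply: (@cvg_trans _ (2 * (1 - eps) / (n%:R - 2) @[n --> \oo])).
    apply: near_eq_cvg; near=> n; rewrite ifT//.
    by near: n; exact: nbhs_infty_gt.
  apply: cvg_const_div; apply/cvgryPge => A; near=> n.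
  by rewrite lerBrDr; near: n; exact: nbhs_infty_ger.
- apply: (@cvg_trans _ ((1 + eps) / n%:R + 2 / ln n%:R @[n --> \oo])).
    apply: near_eq_cvg; near=> n; rewrite ifT//; apply/andP; split.
      by near: n; exact: nbhs_infty_ge.
    rewrite mulrC -ler_pdivrMr//; near: n.
    by have /cvgryPge := @cvg_ln_nat R; exact.
  have := cvgD (cvg_const_div (1 + eps) (@cvgr_idn R))
    (cvg_const_div 2 (@cvg_ln_nat R)).
  by rewrite addr0; exact.
move=> n d Omega P e me ue ie t.
set E := [set w | _].
have PE : P E = (#|connected_histories n t|%:R / #|{: edge n}|%:R ^+ t)%:E.
  rewrite -(probability_history me ue ie); congr (P _).
  by apply/seteqP; split => w; rewrite /E /= connected_graph_process.
have mE1 : #|connected_histories n t|%:R / #|{: edge n}|%:R ^+ t <= 1 :> R.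
  (* With no edges and [t > 0] the denominator is 0, and the quotient is 0 by convention. *)
  have [->|M0] := eqVneq (#|{: edge n}|%:R ^+ t : R) 0.
    by rewrite invr0 mulr0.
  rewrite ler_pdivrMr ?mul1r; last by rewrite lt_def M0 exprn_ge0.
  by rewrite -natrX ler_nat -[X in (_ ^ X)%N](card_ord t) -card_ffun max_card.
rewrite PE !lee_fin; split => tn.
  case: ifPn => [n2|_]; first exact: connected_fraction_le.
  by rewrite addNr powRr0.
case: ifPn => [/andP[n8 eL]|_]; last first.
  by rewrite addNr powRr0 subrr divr_ge0// exprn_ge0.
(* The claim becomes a bound on the complementary fraction, as the two fractions add up to 1. *)
rewrite lerBlDl -lerBlDr.
apply: le_trans (not_connected_fraction_le heps n8 eL tn).
have M0 : 0 < #|{: edge n}|%:R ^+ t :> R.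
  by rewrite exprn_gt0// card_edge ltr0n bin_gt0; lia.
rewrite lerBlDr -mulrDl -natrD addnC cardsC card_ffun card_ord natrX divff//.
by rewrite gt_eqF.
Unshelve. all: by end_near.
Qed.
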